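(* Let $\mathcal{L}=(L,\dot\wedge,\dot\vee,\star,\dot\to,0,1)$ be an SL-algebra. For $a\in L$ write $a\gg 0$ if for every $b\in L$, $a\,\dot\vee\, b=0$ implies $b=0$. For $a\in L$, $\mathbf{a}\in L^2$ and $r\in L$ with $r\gg 0$, let $$N_r(a)=\{b\in L: d_\star(a,b)<r\},\qquad \mathbf{N}_r(\mathbf{a})=\{\mathbf{b}\in L^2:\mathbf{d}_\star(\mathbf{a},\mathbf{b})<r\}.$$ Then $$T_\star=\{G\subseteq L:\ \forall a\in G\ \exists r\in L \text{ with } r\gg 0 \text{ and } N_r(a)\subseteq G\}$$ is a topology on $L$ and $$\mathbf{T}_\star=\{G\subseteq L^2:\ \forall \mathbf{a}\in G\ \exists r\in L \text{ with } r\gg 0 \text{ and } \mathbf{N}_r(\mathbf{a})\subseteq G\}$$ is a topology on $L^2$. Furthermore, the mappings $\star:(L^2,\mathbf{T}_\star)\to(L,T_\star)$ and $\dot\to:(L^2,\mathbf{T}_\star)\to(L,T_\star)$ are continuous.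
   Context: An SL-algebra is an algebra $\mathcal{L}=(L,\dot\wedge,\dot\vee,\star,\dot\to,0,1)$ of type $(2,2,2,2,0,0)$ such that: (SL1) $(L,\dot\wedge,\dot\vee,0,1)$ is a bounded lattice with greatest element $1$ and smallest element $0$, where the order is given by $a\le b$ iff $a\,\dot\vee\, b=a$, so that $a\,\dot\vee\, b=\inf\{a,b\}$ and $a\,\dot\wedge\, b=\sup\{a,b\}$; (SL2) $(L,\star,0)$ is an Abelian monoid; (SL3) $a\ge b\,\dot\to\, c$ iff $a\star b\ge c$ for all $a,b,c\in L$; (SL4) $a\,\dot\wedge\, b=a\star(a\,\dot\to\, b)$ for all $a,b\in L$; (SL5) $(a\,\dot\to\, b)\,\dot\vee\,(b\,\dot\to\, a)=0$ for all $a,b\in L$. Elements of $L^2$ are written $\mathbf{a}=(a_1,a_2)$. Define $d_\star:L\times L\to L$ by $d_\star(a,b)=(a\,\dot\to\, b)\star(b\,\dot\to\, a)$ and $\mathbf{d}_\star:L^2\times L^2\to L$ by $\mathbf{d}_\star(\mathbf{a},\mathbf{b})=d_\star(a_1,b_1)\star d_\star(a_2,b_2)$. Here $x<r$ means $x\le r$ and $x\ne r$. *)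

(* Defs.v *)
From HB Require Import structures.
From mathcomp Require Import all_boot all_order.
From mathcomp Require Import all_classical topology.

Set Implicit Arguments.
Unset Strict Implicit.
Unset Printing Implicit Defensive.

Import Order.TTheory.
Local Open Scope order_scope.
Local Open Scope classical_set_scope.

Declare Scope sl_scope.
Delimit Scope sl_scope with SL.

(* The dotted operations are swapped with respect to the usual reading of the
   symbols: for the order [a <= b <-> a \dotvee b = a], dotted "vee" is the
   infimum and dotted "wedge" is the supremum. *)
Notation "a \dotvee b" := (Order.meet a b)
  (at level 50, left associativity) : sl_scope.
Notation "a \dotwedge b" := (Order.join a b)
  (at level 50, left associativity) : sl_scope.
Local Open Scope sl_scope.

(* The bounded lattice reduct is the inherited [tbLatticeType], with 0 = \bot and
   1 = \top. *)
HB.mixin Record TBLattice_isSLAlgebra d L of Order.TBLattice d L := {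
  sl_star : L -> L -> L;
  sl_arrow : L -> L -> L;
  sl_starA : associative sl_star;
  sl_starC : commutative sl_star;
  sl_star0 : right_id \bot sl_star;
  sl_residuation : forall a b c : L, (sl_arrow b c <= a) <-> (c <= sl_star a b);
  sl_divisibility : forall a b : L, a \dotwedge b = sl_star a (sl_arrow a b);
  sl_prelinearity : forall a b : L, sl_arrow a b \dotvee sl_arrow b a = \bot
}.

#[short(type="slAlgType")]
HB.structure Definition SLAlgebra d :=
  { L of TBLattice_isSLAlgebra d L & Order.TBLattice d L }.

Notation "a \star b" := (sl_star a b)
  (at level 40, left associativity) : sl_scope.
Notation "a \dotto b" := (sl_arrow a b)
  (at level 45, no associativity) : sl_scope.

Section Neighbourhoods.
Context {d : Order.disp_t} {L : slAlgType d}.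

Definition d_star (a b : L) : L := (a \dotto b) \star (b \dotto a).

Definition d_star2 (a b : L * L) : L := d_star a.1 b.1 \star d_star a.2 b.2.

Definition gg0 (a : L) : Prop := forall b : L, a \dotvee b = \bot -> b = \bot.

Definition N_ (r a : L) : set L := [set b | d_star a b < r].

Definition N2_ (r : L) (a : L * L) : set (L * L) := [set b | d_star2 a b < r].

End Neighbourhoods.

Definition T_star {d : Order.disp_t} (L : slAlgType d) : set (set L) :=
  [set G | forall a, G a -> exists2 r : L, gg0 r & N_ r a `<=` G].

Definition T_star2 {d : Order.disp_t} (L : slAlgType d) : set (set (L * L)) :=
  [set G | forall a, G a -> exists2 r : L, gg0 r & N2_ r a `<=` G].

Arguments T_star {d} L _.
Arguments T_star2 {d} L _.

Record is_topology (X : Type) (T : set (set X)) : Prop := {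
  topology_set0 : T set0;
  topology_setT : T setT;
  topology_setI : forall A B, T A -> T B -> T (A `&` B);
  topology_bigcup : forall F : set (set X), F `<=` T -> T (\bigcup_(A in F) A)
}.

(* [X] as a [topologicalType] whose open sets are the members of [T]
   (see [open_spaceE]). *)
Definition space (X : choiceType) (T : set (set X)) (hT : is_topology T) : Type
  := X.

Section Space.
Variables (X : choiceType) (T : set (set X)) (hT : is_topology T).

HB.instance Definition _ := Choice.on (space hT).

Lemma space_bigcup (I : Type) (f : I -> set (space hT)) :
  (forall i, T (f i)) -> T (\bigcup_i f i).
Proof.
move=> Tf; rewrite -(bigcup_image setT f id).
by apply: (topology_bigcup hT) => _ [i _ <-].
Qed.

HB.instance Definition _ := isOpenTopological.Build (space hT)
  (topology_setT hT) (topology_setI hT) space_bigcup.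

Lemma open_spaceE : (@open (space hT) : set (set X)) = T.
Proof. by []. Qed.

End Space.

Definition continuous_map (X Y : choiceType) (T : set (set X))
    (U : set (set Y)) (hT : is_topology T) (hU : is_topology U)
    (f : X -> Y) : Prop :=
  let g : space hT -> space hU := f in continuous g.

(* Main.v *)
(* Both operations are nonexpansive: the distance of the values at [a] and [b] is
   at most [d_star2 a b], by residuation. Hence a radius that works at the image
   point also works at the source point. *)
Require Import Defs.
From mathcomp Require Import all_boot all_order.
From mathcomp Require Import all_classical topology.
Import Order.TTheory.
Local Open Scope order_scope.
Local Open Scope classical_set_scope.
Local Open Scope sl_scope.

Section SLAlgebraTheory.
Context {d : Order.disp_t} {L : slAlgType d}.
Implicit Types a b c r s : L.

Lemma sl_starACA : interchange (@sl_star d L) (@sl_star d L).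
Proof. by move=> x y z t; rewrite !sl_starA -(sl_starA x y) (sl_starC y) sl_starA. Qed.

Lemma le_star_arrow a b : b <= (a \dotto b) \star a.
Proof. exact/sl_residuation. Qed.

(** Residuation yields monotonicity: [c \dotto (a \star c)] lies below [a], hence below [b]. *)
Lemma le_star2r c {a b} : a <= b -> a \star c <= b \star c.
Proof.
by move=> ab; apply/sl_residuation/(le_trans _ ab)/sl_residuation.
Qed.

Lemma le_star2 a a' b b' : a <= a' -> b <= b' -> a \star b <= a' \star b'.
Proof.
move=> aa' bb'; apply: (le_trans (le_star2r b aa')).
by rewrite !(sl_starC a'); apply: le_star2r.
Qed.

Lemma arrow_star_le a1 a2 b1 b2 :
  (a1 \star a2) \dotto (b1 \star b2) <= (a1 \dotto b1) \star (a2 \dotto b2).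
Proof.
by apply/sl_residuation; rewrite sl_starACA le_star2 ?le_star_arrow.
Qed.

(** The first argument of [\dotto] is contravariant, hence [b1 \dotto a1]. Residuating twice leaves
    an upper bound for [b2], reached through the chain [b2], [a2], [a1], [b1] by [le_star_arrow] at
    each link. *)
Lemma arrow_arrow_le a1 a2 b1 b2 :
  (a1 \dotto a2) \dotto (b1 \dotto b2) <= (b1 \dotto a1) \star (a2 \dotto b2).
Proof.
do 2 apply/sl_residuation.
apply: (le_trans (le_star_arrow a2 b2)).
rewrite (sl_starC (b1 \dotto a1)) -!sl_starA le_star2 //.
apply: (le_trans (le_star_arrow a1 a2)).
by rewrite sl_starA (sl_starC (b1 \dotto a1)) -sl_starA le_star2 ?le_star_arrow.
Qed.

Lemma d_star_star_le (a b : L * L) :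
  d_star (a.1 \star a.2) (b.1 \star b.2) <= d_star2 a b.
Proof. by rewrite /d_star2 /d_star sl_starACA le_star2 ?arrow_star_le. Qed.

Lemma d_star_arrow_le (a b : L * L) :
  d_star (a.1 \dotto a.2) (b.1 \dotto b.2) <= d_star2 a b.
Proof.
(* Swapping the two factors of [d_star a.1 b.1] first makes the interchange pair them as
   contravariance requires. *)
rewrite /d_star2 /d_star (sl_starC (a.1 \dotto b.1)) sl_starACA.
by rewrite le_star2 ?arrow_arrow_le.
Qed.

Lemma gg0_top : gg0 (\top : L).
Proof. by move=> b; rewrite meet1x. Qed.

Lemma gg0_meet r s : gg0 r -> gg0 s -> gg0 (r \dotvee s).
Proof. by move=> r0 s0 b; rewrite -meetA => /r0/s0. Qed.

End SLAlgebraTheory.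

(** The radii contain [\top] and are closed under meets, which gives the whole space and binary
    intersections. [D] is left general to cover both [d_star] and [d_star2]. *)
Lemma is_topology_balls {d : Order.disp_t} {L : slAlgType d} {X : Type}
    (D : X -> X -> L) :
  is_topology [set G : set X |
    forall a, G a -> exists2 r : L, gg0 r & [set b | D a b < r] `<=` G].
Proof.
split=> [//|a _|A B TA TB a [Aa Ba]|F FT a [A FA Aa]].
- by exists \top; first exact: gg0_top.
- have [r r0 rA] := TA a Aa; have [s s0 sB] := TB a Ba.
  exists (r \dotvee s); first exact: gg0_meet.
  by move=> b ab; split; [apply: rA|apply: sB];
    apply: (lt_le_trans ab); rewrite (leIl, leIr).
- by have [r r0 rA] := FT A FA a Aa; exists r => // b /rA; exists A.
Qed.

Lemma continuous_nonexpansive (d : Order.disp_t) (L : slAlgType d)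
    (hT : is_topology (T_star L)) (hT2 : is_topology (T_star2 L))
    (f : L * L -> L) :
  (forall a b, d_star (f a) (f b) <= d_star2 a b) -> continuous_map hT2 hT f.
Proof.
move=> fD; apply/continuousP => G; rewrite !open_spaceE => TG a Ga.
have [r r0 rG] := TG _ Ga; exists r => // b ab.
by apply: rG; apply: le_lt_trans (fD a b) ab.
Qed.

Theorem theorem5p8 (d : Order.disp_t) (L : slAlgType d) :
  exists (hT : is_topology (T_star L)) (hT2 : is_topology (T_star2 L)),
    continuous_map hT2 hT (fun x => x.1 \star x.2) /\
    continuous_map hT2 hT (fun x => x.1 \dotto x.2).
Proof.
(* [T_star] and [T_star2] unfold to the ball families of these two distances. *)
exists (is_topology_balls d_star), (is_topology_balls d_star2).
by split; apply: continuous_nonexpansive => a b;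
  [exact: d_star_star_le|exact: d_star_arrow_le].
Qed.
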